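(* Let $\gamma\in C(J,\mathbb F)$ with $\gamma(t)\neq 0$ for all $t\in J$. Then: (a) If $\gamma\,UC(J,X)\subset M(\gamma\,UC(J,X))$, then $\gamma\,UC(J,X)$ satisfies $(\Delta)$. (b) If $\gamma\,BUC(J,X)\subset M(\gamma\,BUC(J,X))$, then $\gamma\,BUC(J,X)$ satisfies $(\Delta)$.
   Context: $X\neq\{0\}$ is a Banach space with scalar field $\mathbb F\in\{\mathbb R,\mathbb C\}$; $J$ is an interval of the form $[\alpha,\infty)$, $(\alpha,\infty)$ (with $\alpha\in\mathbb R$) or $\mathbb R$. $C(J,\cdot)$, $UC(J,X)$, $BUC(J,X)$ denote the continuous, the uniformly continuous, and the bounded uniformly continuous functions on $J$. $L^1_{\rm loc}(J,X)$ is the set of all functions $f:J\to X$ (functions, not equivalence classes) that are Bochner–Lebesgue integrable over every compact interval contained in $J$. For $A\subset X^J$ write $\gamma A=\{\gamma f: f\in A\}$ (pointwise product). For $f:J\to X$ and $h>0$, $(\Delta_h f)(t)=f(t+h)-f(t)$, and for $f\in L^1_{\rm loc}(J,X)$, $(M_hf)(t)=\frac1h\int_0^h f(t+s)\,ds$, $t\in J$. The mean extension of $A\subset X^J$ is $MA=\{f\in L^1_{\rm loc}(J,X): M_hf\in A\text{ for all }h>0\}$. A set $A\subset X^J$ satisfies $(\Delta)$ if: whenever $f\in L^1_{\rm loc}(J,X)$ and $\Delta_a f\in A$ for all $a>0$, then $f-M_hf\in A$ for all $h>0$. *)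

(* Defs.v *)
From HB Require Import structures.
From mathcomp Require Import all_boot all_order all_algebra.
From mathcomp Require Import complex.
From mathcomp Require Import all_classical all_reals all_analysis.

Set Implicit Arguments.
Unset Strict Implicit.
Unset Printing Implicit Defensive.
Import Order.TTheory GRing.Theory Num.Theory.
Import numFieldNormedType.Exports.
Local Open Scope classical_set_scope.
Local Open Scope ring_scope.

Inductive scalars : Set := RealScalars | ComplexScalars.

Definition scalarField (R : realType) (k : scalars) : numFieldType :=
  match k with RealScalars => R | ComplexScalars => R[i] end.

Definition toScalar (R : realType) (k : scalars) : R -> scalarField R k :=
  match k return R -> scalarField R k with
  | RealScalars => fun r => r
  | ComplexScalars => fun r => (r%:C)%C
  end.

Definition scalarRe (R : realType) (k : scalars) : scalarField R k -> R :=
  match k return scalarField R k -> R with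
  | RealScalars => fun r => r
  | ComplexScalars => fun z => complex.Re z
  end.

(* In a [normedModType R[i]] the norm is [R[i]]-valued (real and nonnegative);
   [rnorm] is the same norm with values in [R]. *)
Definition rnorm (R : realType) (k : scalars)
    (X : normedModType (scalarField R k)) (x : X) : R :=
  scalarRe `|x|.

Section Bochner.
Context (R : realType) (k : scalars)
  (X : completeNormedModType (scalarField R k)).

(* [R] with the sigma-algebra of Lebesgue (not just Borel) measurable sets *)
Local Notation lebR := (caratheodory_type (@wlength R idfun)^*%mu).
Local Notation mu := (@completed_lebesgue_measure R).

Definition simple_fun (s : R -> X) : Prop :=
  finite_set (range s) /\
  forall x, measurable (s @^-1` [set x] : set lebR).

Definition simple_integral (a b : R) (s : R -> X) : X :=
  \sum_(x \in range s)
    toScalar k (fine (mu (`[a, b] `&` s @^-1` [set x]))) *: x.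

Definition bochner_approx (a b : R) (f : R -> X) (s : nat -> R -> X) : Prop :=
  [/\ forall n, simple_fun (s n),
      {ae mu, forall t : R, t \in `[a, b] -> s n t @[n --> \oo] --> f t} &
      (\int[mu]_(t in `[a, b]) (rnorm (f t - s n t))%:E)%E @[n --> \oo]
        --> 0%E].

Definition bochner_integrable (a b : R) (f : R -> X) : Prop :=
  exists s, bochner_approx a b f s.

(* The limit does not depend on the approximating sequence; the value is a
   default one if [f] is not Bochner integrable over [[a, b]]. *)
Definition bochner_integral (a b : R) (f : R -> X) : X :=
  get [set v | exists2 s, bochner_approx a b f s &
                 simple_integral a b (s n) @[n --> \oo] --> v].

End Bochner.

Definition admissible_interval (R : realType) (J : set R) : Prop :=
  [\/ exists alpha : R, J = `[alpha, +oo[%classic,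
      exists alpha : R, J = `]alpha, +oo[%classic |
      J = setT].

(* A function [J -> X] is represented by a total function [R -> X] whose values
   outside [J] are irrelevant: all the sets of functions below are closed under
   modification outside [J], and [t + s] stays in [J] for [t] in [J], [0 <= s]. *)
Section FunctionSpaces.
Context (R : realType) (k : scalars)
  (X : completeNormedModType (scalarField R k)).
Implicit Types (J : set R) (f : R -> X) (A : set (R -> X)).

Definition UC J : set (R -> X) :=
  [set f | unif_continuous (f : subspace J -> X)].

Definition BUC J : set (R -> X) := UC J `&` [set f | [bounded f t | t in J]].

Definition weighted J (gamma : R -> scalarField R k) A : set (R -> X) :=
  [set g | exists2 f, A f & forall t, J t -> g t = gamma t *: f t].

Definition L1loc J : set (R -> X) :=
  [set f | forall a b, a <= b -> `[a, b] `<=` J -> bochner_integrable a b f].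

Definition shift_diff (h : R) f : R -> X := fun t => f (t + h) - f t.

Definition shift_mean (h : R) f : R -> X :=
  fun t => toScalar k h^-1 *: bochner_integral 0 h (fun s => f (t + s)).

Definition mean_ext J A : set (R -> X) :=
  [set f | L1loc J f /\ forall h, 0 < h -> A (shift_mean h f)].

Definition DeltaProp J A : Prop :=
  forall f, L1loc J f -> (forall a, 0 < a -> A (shift_diff a f)) ->
  forall h, 0 < h -> A (fun t => f t - shift_mean h f t).

End FunctionSpaces.

Arguments UC {R k} X J.
Arguments BUC {R k} X J.

(* Main.v *)
Require Import Defs.
From HB Require Import structures.
From mathcomp Require Import all_boot all_order all_algebra finmap.
From mathcomp Require Import complex.
From mathcomp Require Import all_classical all_reals all_analysis.
From mathcomp Require Import measurable_realfun lra ring.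
Set Implicit Arguments.
Unset Strict Implicit.
Unset Printing Implicit Defensive.
Import Order.TTheory GRing.Theory Num.Theory.
Import numFieldNormedType.Exports.
Local Open Scope classical_set_scope.
Local Open Scope ring_scope.

(** Write [g_s = gamma^-1 (f (. + s) - f)]; all the [g_s] with [s > 0] lie in the
    space [A] of (bounded) uniformly continuous functions, and the claim is that
    [gamma^-1 (f - M_h f)], which is minus the average of [g_s] over
    [0 <= s <= h], lies in [A] too.  Only a uniform control of the modulus of
    continuity of [g_s] over a whole interval of parameters [s] would let one
    average directly, and near [s = 0] such a control need not be at hand:
    [g_(s+c) t - g_c t] is [g_s (t + c)] times [gamma (t + c) / gamma t], a factor
    without evident lower bound.  The proof gets around this in three moves.

    Continuity of [f].  If [tau_n] tends to [t] then
    [f (tau_n + s) - f (t + s) - (f tau_n - f t)] tends to 0 for every [s > 0].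
    Bochner integrability makes [f] nearly constant on some set of positive
    measure, hence on a compact set [K] of positive measure, and some [x] in [K]
    returns to [K] under infinitely many of the small translations [tau_n - t];
    taking [s = x - t] forces [f tau_n - f t] to be small
    ([L1loc_shift_diff_continuous]).

    Baire.  As [f] is continuous, for each [e > 0] the parameters [s] for which
    the oscillation of [g_s] over distances less than [1/(n+1)] is at most [e]
    (and [g_s] is bounded by [n]) form a closed set.  These sets cover the line,
    so one of them contains an interval [[c, d]] with [0 < c < d]
    ([equicontinuous_on_interval]).

    Transport.  Cut [[0, h]] into [m] pieces of length [r = h/m], so small that
    some [[p r, (p + 1) r]] fits in [[c, d]].  Averaging over the pieces gives
    [M_h f = M_r f + 1/m sum_(j < m) M_r (Delta_(j r) f)] and
    [M_r f (. + p r) = M_r f + M_r (Delta_(p r) f)], hence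
    [f - M_h f = (f - M_r f (. + p r)) + M_r (Delta_(p r) f)
                 - 1/m sum_(j < m) M_r (Delta_(j r) f)].
    The hypothesis [gamma A <= M (gamma A)] is exactly what puts every
    [M_r (Delta_(j r) f)] in [gamma A].  The remaining term, divided by [gamma],
    is minus an average of the [g_s] with [c <= s <= d], so it oscillates by at
    most [e].  Since [e] is arbitrary, [gamma^-1 (f - M_h f)] is in [A].

    Once [f] is known to be continuous, every Bochner integral that occurs is a
    limit of Riemann sums ([cvg_shift_mean]), and the identities and estimates
    for means reduce to those for finite averages. *)

(** * Real-valued norms over real or complex scalars *)

Section Scalars.
Context {R : realType} {k : scalars}.
Local Notation F := (scalarField R k).
Local Notation toF := (@toScalar R k).
Local Notation re := (@scalarRe R k).

Lemma toScalarK : cancel toF re.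
Proof. by rewrite /toScalar /scalarRe; case: k. Qed.

Lemma toScalarB (a b : R) : toF (a - b) = toF a - toF b.
Proof. by rewrite /toScalar; case: k => //; rewrite rmorphB. Qed.

Lemma toScalarM (a b : R) : toF (a * b) = toF a * toF b.
Proof. by rewrite /toScalar; case: k => //; rewrite rmorphM. Qed.

Lemma toScalarD (a b : R) : toF (a + b) = toF a + toF b.
Proof. by rewrite /toScalar; case: k => //; rewrite rmorphD. Qed.

Lemma toScalar0 : toF 0 = 0.
Proof. by rewrite /toScalar; case: k. Qed.

Lemma toScalar1 : toF 1 = 1.
Proof. by rewrite /toScalar; case: k. Qed.

Lemma toScalar_sum (I : Type) (r : seq I) (P : pred I) (G : I -> R) :
  toF (\sum_(i <- r | P i) G i) = \sum_(i <- r | P i) toF (G i).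
Proof. exact: (big_morph _ toScalarD toScalar0). Qed.

Lemma toScalar_nat n : toF n%:R = n%:R.
Proof.
by elim: n => [|n IH]; rewrite ?toScalar0// -natr1 toScalarD IH toScalar1 natr1.
Qed.

Lemma ler_toScalar (a b : R) : (toF a <= toF b) = (a <= b).
Proof. by rewrite /toScalar; case: k => //; rewrite lecR. Qed.

Lemma ltr_toScalar (a b : R) : (toF a < toF b) = (a < b).
Proof. by rewrite /toScalar; case: k => //; rewrite ltcR. Qed.

Lemma toScalar_real (a : R) : toF a \is Num.real.
Proof. by rewrite realE -toScalar0 !ler_toScalar le_total. Qed.

Lemma scalarReK (z : F) : z \is Num.real -> toF (re z) = z.
Proof.
rewrite /toScalar /scalarRe; move: z; case: k => //= z zr.
by rewrite RRe_real.
Qed.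

Lemma normr_toScalar (a : R) : `|toF a| = toF `|a|.
Proof.
have [a0|a0] := leP 0 a; first by rewrite !ger0_norm// -toScalar0 ler_toScalar.
rewrite !ltr0_norm ?toScalar0//.
- by rewrite -[in LHS](sub0r (toF a)) -{1}toScalar0 -toScalarB sub0r.
- by rewrite -toScalar0 ltr_toScalar.
Qed.

End Scalars.

Section RealNorm.
Context {R : realType} {k : scalars}.
Local Notation F := (scalarField R k).
Local Notation toF := (@toScalar R k).

Section Algebra.
Context {X : normedModType F}.
Implicit Types x y z : X.

Lemma rnormE x : `|x| = toF (rnorm x).
Proof. by rewrite /rnorm scalarReK. Qed.

Lemma rnorm_le x (c : R) : (rnorm x <= c) = (`|x| <= toF c).
Proof. by rewrite rnormE ler_toScalar. Qed.

Lemma rnorm_lt x (c : R) : (rnorm x < c) = (`|x| < toF c).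
Proof. by rewrite rnormE ltr_toScalar. Qed.

Lemma rnorm_ge0 x : 0 <= rnorm x.
Proof. by rewrite -(@ler_toScalar R k) -rnormE toScalar0. Qed.

Lemma rnorm0 : rnorm (0 : X) = 0.
Proof. by apply: (can_inj (@toScalarK R k)); rewrite -rnormE normr0 toScalar0. Qed.

Lemma rnormN x : rnorm (- x) = rnorm x.
Proof. by rewrite /rnorm normrN. Qed.

Lemma rdistC x y : rnorm (x - y) = rnorm (y - x).
Proof. by rewrite /rnorm distrC. Qed.

Lemma ler_rnormD x y : rnorm (x + y) <= rnorm x + rnorm y.
Proof. by rewrite rnorm_le toScalarD -!rnormE ler_normD. Qed.

Lemma ler_rnormB x y : rnorm (x - y) <= rnorm x + rnorm y.
Proof. by rewrite -(rnormN y) ler_rnormD. Qed.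

Lemma ler_rdist_add y x z : rnorm (x - z) <= rnorm (x - y) + rnorm (y - z).
Proof. by have := ler_rnormD (x - y) (y - z); rewrite addrA subrK. Qed.

Lemma rnorm_sum (I : Type) (r : seq I) (P : pred I) (G : I -> X) :
  rnorm (\sum_(i <- r | P i) G i) <= \sum_(i <- r | P i) rnorm (G i).
Proof.
rewrite rnorm_le toScalar_sum.
rewrite (eq_bigr (fun i => `|G i|)); first exact: ler_norm_sum.
by move=> i _; rewrite rnormE.
Qed.

Lemma rnormZ (c : F) x : rnorm (c *: x) = scalarRe `|c| * rnorm x.
Proof.
apply: (can_inj (@toScalarK R k)).
by rewrite -rnormE toScalarM scalarReK// -rnormE normrZ.
Qed.

Lemma rnormZr (c : R) x : rnorm (toF c *: x) = `|c| * rnorm x.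
Proof. by rewrite rnormZ normr_toScalar toScalarK. Qed.

Lemma rnorm_eq0 x : (rnorm x == 0) = (x == 0).
Proof.
apply/eqP/eqP => [x0|->]; last exact: rnorm0.
by apply/eqP; rewrite -normr_eq0 rnormE x0 toScalar0.
Qed.

Lemma ballE x (e : R) y : ball x (toF e) y = (rnorm (x - y) < e) :> Prop.
Proof. by rewrite -ball_normE /ball_/= -rnorm_lt. Qed.

(** In the complex case a positive scalar is real, so the radii used by the
    library topology may all be taken real. *)
Lemma pos_toScalar (e : F) : 0 < e -> exists2 r : R, 0 < r & e = toF r.
Proof.
move=> e0; exists (scalarRe e).
  by rewrite -(@ltr_toScalar R k) scalarReK ?gtr0_real// toScalar0.
by rewrite scalarReK ?gtr0_real.
Qed.

Lemma cvg_rnormP {T : Type} {H : set_system T} {FH : Filter H}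
    (f : T -> X) (l : X) :
  f @ H --> l <-> forall e : R, 0 < e -> \forall x \near H, rnorm (l - f x) < e.
Proof.
split=> [/cvgrPdist_lt fl e e0|fl].
  have /fl : 0 < toF e by rewrite -(@toScalar0 R k) ltr_toScalar.
  by apply: filterS => x; rewrite -rnorm_lt.
apply/cvgrPdist_lt => _ /pos_toScalar[e e0 ->].
by apply: filterS (fl e e0) => x; rewrite -rnorm_lt.
Qed.

Lemma cvg_seq_rnormP (u : nat -> X) (l : X) :
  u @ \oo --> l <->
  forall e : R, 0 < e -> exists N, forall n, (N <= n)%N -> rnorm (l - u n) < e.
Proof.
rewrite cvg_rnormP; split=> h e e0.
  by have [N _ HN] := h e e0; exists N.
by have [N HN] := h e e0; exists N.
Qed.

Lemma rnorm_lim_le (u : nat -> X) (l : X) (c : R) :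
  u @ \oo --> l -> (forall n, rnorm (u n) <= c) -> rnorm l <= c.
Proof.
move=> /cvg_seq_rnormP ul uc; apply/ler_addgt0Pl => e /ul[N HN].
have := ler_rnormD (l - u N) (u N); rewrite subrK => /le_trans; apply.
by rewrite lerD// ltW// HN.
Qed.

Lemma closed_rnorm_le (G : R -> X) (c : R) : continuous G ->
  closed [set s | rnorm (G s) <= c].
Proof.
move=> Gc s cls /=; apply/ler_addgt0Pl => e e0.
have /cvg_rnormP/(_ e e0) /cls[s' [/= Gs' ss']] := Gc s.
have := ler_rnormD (G s - G s') (G s'); rewrite subrK => /le_trans; apply.
by rewrite lerD// ltW.
Qed.

Lemma within_continuous_rnormP (J : set R) (f : R -> X) :
  {within J, continuous f} <->
  forall t, J t -> forall e : R, 0 < e -> exists2 d : R, 0 < d &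
    forall t', J t' -> `|t - t'| < d -> rnorm (f t - f t') < e.
Proof.
rewrite continuous_subspace_in; split.
  move=> fc t Jt e e0.
  have /cvg_rnormP/(_ e e0) H := fc t (mem_set Jt).
  have {H} : within J (nbhs t) [set t' | rnorm (f t - f t') < e].
    by rewrite (nbhs_subspace_in Jt); exact: H.
  move=> /nbhs_ballP[d /= d0 H].
  by exists d => // t' Jt' tt'; exact: (H t' tt' Jt').
move=> fc t /set_mem Jt; apply/cvg_rnormP => e e0.
suff : within J (nbhs t) [set t' | rnorm (f t - f t') < e].
  by rewrite (nbhs_subspace_in Jt).
have [d d0 H] := fc t Jt e e0.
by apply/nbhs_ballP; exists d => //= t' tt' Jt'; exact: H.
Qed.

End Algebra.

End RealNorm.

Section Spaces.
Context {R : realType} {k : scalars} {X : completeNormedModType (scalarField R k)}.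
Implicit Types (f : R -> X) (J : set R).

Lemma UC_rnormP J f : UC X J f <->
  forall e : R, 0 < e -> exists2 d : R, 0 < d &
    forall t t', J t -> J t' -> `|t - t'| < d -> rnorm (f t - f t') < e.
Proof.
split=> [fuc e e0|fuc A].
  have eF : 0 < toScalar k e by rewrite -(@toScalar0 R k) ltr_toScalar.
  have := fuc _ (entourage_ball X (PosNum eF)).
  rewrite near_simpl => -[E]; rewrite -entourage_ballE => -[d /= d0 dE] H.
  exists d => // t t' Jt Jt' tt'.
  have /= := H (t, t'); rewrite ballE; apply; right; split=> //; split=> //.
  by apply: dE => /=.
rewrite -entourage_ballE => -[_ /= /(@pos_toScalar R k)[e e0 ->] H].
have [d d0 Hd] := fuc e e0.
exists [set xy : R * R | ball xy.1 d xy.2].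
  by rewrite -entourage_ballE; exists d.
move=> [t t'] /= tt'; apply: H => /=; rewrite ballE.
by case: tt' => [->|[Jt [Jt' tt']]]; [rewrite subrr rnorm0|exact: Hd].
Qed.

Lemma bounded_rnormP J f : [bounded f t | t in J] <->
  exists M : R, forall t, J t -> rnorm (f t) <= M.
Proof.
split=> [[M [Mr HM]]|[M HM]].
  exists (scalarRe (M + 1)) => t Jt.
  rewrite rnorm_le scalarReK; last by rewrite rpredD// rpred1.
  by apply: (HM (M + 1)) => //; rewrite ltrDl.
exists (toScalar k M); split; first exact: toScalar_real.
move=> N /ltW MN t Jt /=; apply: le_trans MN.
by rewrite -rnorm_le; exact: HM.
Qed.

End Spaces.

(** * Bochner integrals of simple functions *)

Section NonmeasurableMonotone.
Context d (T : measurableType d) (R : realType) (mu : {measure set T -> \bar R}).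
Local Open Scope ereal_scope.

(** A Bochner approximation of [f] controls the integral of [rnorm (f - s n)],
    whose integrand is not a priori measurable.  Monotonicity survives because
    the integral of a nonnegative function is the supremum of the integrals of
    the simple functions below it. *)
Lemma ge0_le_integral_nonmeasurable (D : set T) (f g : T -> \bar R) :
  (forall x, D x -> 0 <= f x) -> (forall x, D x -> f x <= g x) ->
  \int[mu]_(x in D) f x <= \int[mu]_(x in D) g x.
Proof.
move=> f0 fg; rewrite [leLHS]integral_mkcond [leRHS]integral_mkcond.
have fgD x : (f \_ D) x <= (g \_ D) x by exact: lee_restrict.
have f0D x : 0 <= (f \_ D) x by exact: erestrict_ge0.
rewrite !ge0_integralTE//; last by move=> x; exact: le_trans (fgD x).
apply: le_ereal_sup => _ [h hf <-]; exists h => // x.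
exact: le_trans (hf x) (fgD x).
Qed.

End NonmeasurableMonotone.

Section LebesgueCompletion.
Context {R : realType}.
Local Notation lebR := (caratheodory_type (@wlength R idfun)^*%mu).
Local Notation mu := (@completed_lebesgue_measure R).

Lemma borel_lebesgue (A : set R) :
  measurable (A : set (measurableTypeR R)) -> measurable (A : set lebR).
Proof. exact: sub_caratheodory. Qed.

Lemma completed_measure_itv (a b : R) : a <= b -> mu `[a, b]%classic = (b - a)%:E.
Proof.
move=> ab; have -> : mu `[a, b]%classic = @lebesgue_measure R `[a, b]%classic by [].
rewrite lebesgue_measure_itv/= lte_fin; case: ltP => [|ba]; first by [].
by rewrite (_ : a = b) ?subrr//; apply/eqP; rewrite eq_le ab.
Qed.

Lemma integral_cst_segment (c a b : R) : a <= b ->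
  (\int[mu]_(t in `[a, b]) (cst c%:E t) = (c * (b - a))%:E)%E.
Proof.
move=> ab; rewrite integral_cst; last by apply: borel_lebesgue; exact: measurable_itv.
by rewrite EFinM -completed_measure_itv.
Qed.

End LebesgueCompletion.

Section SimpleIntegral.
Context {R : realType} {k : scalars} {X : completeNormedModType (scalarField R k)}.
Local Notation lebR := (caratheodory_type (@wlength R idfun)^*%mu).
Local Notation mu := (@completed_lebesgue_measure R).
Local Notation toF := (@toScalar R k).

(** Simple functions are handled through an index function [iota] with values in
    any choice type: integers for step functions, pairs of values for the common
    refinement of two simple functions. *)
Definition finitely_valued {T : choiceType} (iota : lebR -> T) : Prop :=
  finite_set (range iota) /\ forall i, measurable (iota @^-1` [set i]).

Lemma measurable_index_preimage {T : choiceType} (iota : lebR -> T) (B : set T) :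
  finitely_valued iota -> measurable (iota @^-1` B).
Proof.
move=> [fi mi]; rewrite (_ : _ @^-1` _ =
    \bigcup_(i in range iota `&` B) iota @^-1` [set i]).
  apply: fin_bigcup_measurable => //.
  exact: sub_finite_set (@subIsetl _ _ _) fi.
apply/seteqP; split=> [u /= Bu|u [i [_ /= Bi] ->]]//.
by exists (iota u) => //; split=> //; exists u.
Qed.

Lemma simple_fun_index {T : choiceType} (iota : lebR -> T) (v : T -> X) :
  finitely_valued iota -> simple_fun (v \o iota).
Proof.
move=> fi; split; last first.
  by move=> x; rewrite comp_preimage; exact: measurable_index_preimage.
rewrite (_ : range _ = v @` range iota); first exact: finite_image fi.1.
by rewrite image_comp.
Qed.

Lemma finitely_valued_pair (s s' : R -> X) : simple_fun s -> simple_fun s' ->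
  finitely_valued (fun t => (s t, s' t)).
Proof.
move=> [fs ms] [fs' ms']; split.
  apply: sub_finite_set (finite_setX fs fs').
  by move=> _ [t _ <-]; split; exists t.
move=> i; rewrite (_ : _ @^-1` _ = s @^-1` [set i.1] `&` s' @^-1` [set i.2]).
  exact: measurableI.
by apply/seteqP; split=> [t /= <-//|t [/= -> ->]]; case: (i).
Qed.

Definition segment_measure (a b : R) (A : set lebR) : R :=
  fine (mu (`[a, b]%classic `&` A)).

Section Segment.
Variables a b : R.
Let I : set lebR := `[a, b]%classic.
Local Notation m := (segment_measure a b).

Let mI : measurable I.
Proof. by apply: borel_lebesgue; exact: measurable_itv. Qed.

Lemma fin_segment_measure (A : set lebR) : measurable A ->
  mu (I `&` A) = (m A)%:E.
Proof.
move=> mA; rewrite /segment_measure -/I fineK// ge0_fin_numE//.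
apply: (@le_lt_trans _ _ (mu I)).
  by apply: le_measure; rewrite ?mem_set//; exact: measurableI.
rewrite -[mu I]/(@lebesgue_measure R `[a, b]%classic) lebesgue_measure_itv/=.
by case: ifP => _; rewrite -?EFinB ltry.
Qed.

Lemma segment_measure_ge0 (A : set lebR) : 0 <= m A.
Proof. by rewrite fine_ge0. Qed.

Lemma segment_measure_fibers {T : choiceType} (iota : lebR -> T) (A : set lebR) :
  finitely_valued iota -> measurable A ->
  m A = \sum_(i <- fset_set (range iota)) m (A `&` iota @^-1` [set i]).
Proof.
move=> [fi mi] mA; apply: EFin_inj; rewrite -fin_segment_measure// -sumEFin.
under eq_bigr => i _ do rewrite -(fin_segment_measure (measurableI _ _ mA (mi i))).
rewrite -fsbig_finite// -measure_fin_bigcup//.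
- congr (mu _); apply/seteqP; split=> [x [Ix Ax]|x [i _ [Ix []]]]//.
  by exists (iota x) => //; exists x.
- by move=> i j _ _ [x [[_ [_ <-]] [_ [_ <-]]]].
- by move=> i _; do 2 (apply: measurableI => //).
Qed.

End Segment.

(** The fibers of [iota] refine those of [v \o iota], so additivity of the
    measure lets one sum over indices instead of values. *)
Lemma simple_integral_index {T : choiceType} (iota : lebR -> T) (v : T -> X)
    (a b : R) :
  finitely_valued iota ->
  simple_integral a b (v \o iota) =
  \sum_(i <- fset_set (range iota))
    toF (segment_measure a b (iota @^-1` [set i])) *: v i.
Proof.
move=> fvi; have [fi mi] := fvi; have [fs ms] := simple_fun_index v fvi.
rewrite /simple_integral fsbig_finite//=.
under eq_bigr => x _.
  rewrite -/(segment_measure a b ((v \o iota) @^-1` [set x])).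
  rewrite (segment_measure_fibers a b fvi (ms x)) toScalar_sum scaler_suml.
  over.
rewrite exchange_big/=; apply: eq_big_seq => i.
rewrite in_fset_set// inE => -[u _ ui].
have vis : v i \in fset_set (range (v \o iota)).
  by rewrite in_fset_set// inE; exists u => //=; rewrite ui.
rewrite (bigD1_seq (v i))/= ?fset_uniq// [X in _ + X]big1 ?addr0.
  congr (toF (segment_measure _ _ _) *: _).
  by apply/seteqP; split=> [x []|x /= ->].
move=> x xvi.
rewrite (_ : _ `&` _ = set0) ?/segment_measure ?setI0 ?measure0 ?toScalar0 ?scale0r//.
by apply/seteqP; split=> // y [/= vyx yi]; move: xvi; rewrite -vyx yi eqxx.
Qed.

(** On a common refinement of [s] and [s'], with pieces [P_i] and values [v_i]
    and [w_i], the number [rnorm (v_i - w_i) - eta] bounds [rnorm (f - s)] from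
    below on [P_i].  The simple function with these values is thus below
    [rnorm (f - s)], and integrating it gives the estimate without any
    measurability of [f].  With [s'] uniformly close to [f], this is what makes
    the Bochner integral of [f] independent of the approximation [s]. *)
Lemma simple_integral_dist_le (a b eta : R) (f s s' : R -> X) : a <= b ->
  simple_fun s -> simple_fun s' ->
  (forall t, t \in `[a, b] -> rnorm (f t - s' t) <= eta) ->
  ((rnorm (simple_integral a b s - simple_integral a b s'))%:E <=
   \int[mu]_(t in `[a, b]) (rnorm (f t - s t))%:E + (eta * (b - a))%:E)%E.
Proof.
move=> ab simple_s simple_s' fs'eta.
pose iota (t : lebR) := (s t, s' t).
have fvi : finitely_valued iota by exact: finitely_valued_pair.
have [fi mi] := fvi.
rewrite -[s]/(fst \o iota) -[s']/(snd \o iota) !simple_integral_index//.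
rewrite -sumrB; set r := fset_set (range iota).
pose m i := segment_measure a b (iota @^-1` [set i]).
(* [w i] bounds [rnorm (f - s)] from below on the piece [i]. *)
pose w (i : X * X) := Num.max 0 (rnorm (i.1 - i.2) - eta).
have w0 i : 0 <= w i by rewrite le_max lexx.
have summ : \sum_(i <- r) m i = b - a.
  apply: EFin_inj; rewrite -completed_measure_itv// -(setIT `[a, b]%classic).
  rewrite fin_segment_measure//; congr EFin.
  rewrite (segment_measure_fibers a b fvi)//.
  by apply: eq_bigr => i _; rewrite setTI.
apply: (@le_trans _ _ ((\sum_(i <- r) m i * w i)%:E + (eta * (b - a))%:E)%E).
  rewrite -EFinD lee_fin -summ mulr_sumr -big_split/=.
  apply: le_trans (rnorm_sum _ _ _) _; apply: ler_sum => i _.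
  rewrite -scalerBr rnormZr ger0_norm ?segment_measure_ge0// -/(m i).
  rewrite (mulrC eta) -mulrDr ler_wpM2l ?segment_measure_ge0//.
  by rewrite -lerBlDr le_max lexx orbT.
rewrite leeD2r// -sumEFin.
have mI : measurable (`[a, b]%classic : set lebR).
  by apply: borel_lebesgue; exact: measurable_itv.
under eq_bigr => i _.
  rewrite EFinM muleC -fin_segment_measure// setIC -integral_indic//.
  rewrite -(@integralZl_indic _ _ _ _ _ mI (fun=> iota @^-1` [set i]))//; last first.
    by move=> wi; have := w0 i; rewrite leNgt wi.
  over.
rewrite -fsbig_finite//= -ge0_integral_fsum//; last 2 first.
- move=> i; apply/measurable_EFinP; apply: measurable_funM => //; exact: measurable_indic.
- by move=> i x _; rewrite lee_fin mulr_ge0.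
apply: ge0_le_integral_nonmeasurable => t Dt.
  by apply: fsume_ge0 => i _; rewrite lee_fin mulr_ge0.
rewrite fsbig_finite//= -/r sumEFin lee_fin.
rewrite (bigD1_seq (iota t))/= ?fset_uniq//; last first.
  by rewrite in_fset_set// inE; exists t.
rewrite [X in _ + X]big1 ?addr0; last first.
  move=> i ti; rewrite indicE memNset ?mulr0//= => E.
  by move: ti; rewrite -E eqxx.
rewrite indicE mem_set//= mulr1 /w ge_max rnorm_ge0/= lerBlDr.
apply: le_trans (ler_rdist_add (f t) _ _) _.
by rewrite rdistC lerD2l fs'eta.
Qed.

End SimpleIntegral.

(** * Bochner integrals of continuous functions as limits of Riemann sums *)

(** The Lebesgue number lemma: a property that holds at a scale depending on the
    point holds at a uniform scale on a compact set. *)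
Lemma compact_lebesgue_number {R : realType} (K : set R) (Q : R -> R -> Prop) :
  compact K ->
  (forall x, K x -> exists2 d : R, 0 < d &
    forall x' y, K x' -> `|x - x'| < d -> `|x - y| < d -> Q x' y) ->
  exists2 d : R, 0 < d & forall x y, K x -> `|x - y| < d -> Q x y.
Proof.
move=> /compact_near_coveringP cK KQ.
have [] := cK R (0^'+) (fun d x => K x -> forall y, `|x - y| < d -> Q x y) _.
  move=> x Kx; have [d d0 H] := KQ x Kx.
  have d20 : 0 < d / 2 by rewrite divr_gt0.
  exists (ball x (d / 2), [set t | 0 < t < d / 2]).
    split; first exact: nbhsx_ballx.
    by near=> t => /=; apply/andP; split; near: t;
      [exact: nbhs_right_gt|exact: nbhs_right_lt].
  move=> [x' t] /= [xx' /andP[t0 td]] Kx' y x'y.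
  have xx'd : `|x - x'| < d / 2 by [].
  apply: H => //.
    by rewrite (lt_trans xx'd)// ltr_pdivrMr// ltr_pMr// ltr1n.
  rewrite (splitr d) (le_lt_trans (ler_distD x' _ _))// ltrD//.
  exact: lt_trans td.
move=> d /= d0 H; have d20 : 0 < d / 2 by rewrite divr_gt0.
exists (d / 2) => // x y Kx xy; apply: (H (d / 2)) xy => //.
by rewrite /ball_/= sub0r normrN gtr0_norm// ltr_pdivrMr// ltr_pMr// ltr1n.
Unshelve. all: by end_near. Qed.

Section Riemann.
Context {R : realType} {k : scalars} {X : completeNormedModType (scalarField R k)}.
Local Notation lebR := (caratheodory_type (@wlength R idfun)^*%mu).
Local Notation mu := (@completed_lebesgue_measure R).
Local Notation toF := (@toScalar R k).

Lemma segment_unif_continuous (f : R -> X) (a b : R) :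
  {within `[a, b], continuous f} ->
  forall e : R, 0 < e -> exists2 d : R, 0 < d &
    forall x y, x \in `[a, b] -> y \in `[a, b] -> `|x - y| < d ->
      rnorm (f x - f y) < e.
Proof.
move=> /within_continuous_rnormP fc e e0.
have e20 : 0 < e / 2 by rewrite divr_gt0.
have [|d d0 H] := @compact_lebesgue_number R `[a, b]%classic
    (fun x y => y \in `[a, b] -> rnorm (f x - f y) < e) (@segment_compact R a b).
  move=> x xab; have [d d0 H] := fc x xab _ e20.
  exists d => // x' y x'ab xx' xy yab.
  rewrite (splitr e); apply: le_lt_trans (ler_rdist_add (f x) _ _) _.
  by rewrite ltrD//; [rewrite rdistC|]; exact: H.
by exists d => // x y xab yab xy; exact: H.
Qed.

Lemma cvg_ereal0P (u : nat -> \bar R) : (forall n, 0 <= u n)%E ->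
  (u @ \oo --> 0%E <->
   forall e : R, 0 < e -> exists N, forall n, (N <= n)%N -> (u n <= e%:E)%E).
Proof.
move=> u0; split=> [/fine_cvgP[ufin /cvgrPdist_lt ul] e e0|ul].
  have [N _ HN] := filterI ufin (ul e e0).
  exists N => n /HN[/= fu]; rewrite sub0r normrN ger0_norm ?fine_ge0// => ue.
  by rewrite -(fineK fu) lee_fin ltW.
apply/fine_cvgP; split.
  have [N HN] := ul _ ltr01; exists N => // n /HN un.
  by rewrite ge0_fin_numE// (le_lt_trans un)// ltry.
apply/cvgrPdist_le => e e0; have [N HN] := ul e e0; exists N => // n /HN un.
rewrite /= sub0r normrN ger0_norm ?fine_ge0// -lee_fin fineK//.
by rewrite ge0_fin_numE// (le_lt_trans un)// ltry.
Qed.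

Section StepFunctions.
Variables (r : R) (r0 : 0 < r).
Implicit Types (n i : nat) (phi : R -> X).

Definition grid n i : R := i%:R * (r / n.+1%:R).

(** The truncation at [n] puts the right endpoint [r] in the last cell and keeps
    the range finite. *)
Definition step_index n (x : lebR) : nat :=
  minn n (Num.truncn (x / (r / n.+1%:R))).

Let rn0 n : 0 < r / n.+1%:R.
Proof. by rewrite divr_gt0. Qed.

Lemma gridS n i : grid n i.+1 = grid n i + r / n.+1%:R.
Proof. by rewrite /grid -natr1 mulrDl mul1r. Qed.

Lemma grid_full n : grid n n.+1 = r.
Proof. by rewrite /grid mulrC divfK. Qed.

Lemma grid_ge0 n i : 0 <= grid n i.
Proof. by rewrite mulr_ge0// ltW. Qed.

Lemma grid_le n i : (i <= n.+1)%N -> grid n i <= r.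
Proof.
by move=> ile; rewrite -[leRHS](grid_full n) ler_wpM2r ?ler_nat// ltW.
Qed.

Lemma step_index_gt n x i : (i < step_index n x)%N = (i < n)%N && (grid n i.+1 <= x).
Proof. by rewrite leq_min truncn_gt_nat ler_pdivlMr. Qed.

Lemma range_step_index n : range (step_index n) = `I_n.+1.
Proof.
apply/seteqP; split=> [_ [x _ <-]|i /= ilt]; first by rewrite /= ltnS geq_minl.
exists (grid n i) => //; rewrite /step_index /grid mulfK ?gt_eqF// natrK.
exact/minn_idPr.
Qed.

Lemma finitely_valued_step_index n : finitely_valued (step_index n).
Proof.
split=> [|i]; first by rewrite range_step_index; exact: finite_II.
have mge j : measurable ([set x : lebR | (j <= step_index n x)%N]).
  case: j => [|j].
    by rewrite (_ : [set _ | _] = setT); [exact: measurableT|exact/seteqP].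
  have [jn|nj] := ltnP j n.
    rewrite (_ : [set _ | _] = `[grid n j.+1, +oo[%classic).
      by apply: borel_lebesgue; exact: measurable_itv.
    by apply/seteqP; split=> x /=; rewrite step_index_gt jn in_itv/= andbT.
  rewrite (_ : [set _ | _] = set0); first exact: measurable0.
  by apply/seteqP; split=> x //=; rewrite step_index_gt ltnNge nj.
rewrite (_ : _ @^-1` _ = [set x | (i <= step_index n x)%N] `\`
                         [set x | (i < step_index n x)%N]).
  exact: measurableD.
apply/seteqP; split=> [x /= <-|x /= [ix /negP]]; first by rewrite leqnn ltnn.
by rewrite -leqNgt => xi; apply/eqP; rewrite eqn_leq ix xi.
Qed.

Lemma segment_measure_step n i : (i <= n)%N ->
  segment_measure 0 r (step_index n @^-1` [set i]) = r / n.+1%:R.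
Proof.
move=> ilen; rewrite /segment_measure.
have gi : forall x, 0 <= x -> (i <= step_index n x)%N = (grid n i <= x).
  move=> x x0; case: (i) ilen => [|j] jn; last by rewrite step_index_gt jn.
  by rewrite /grid mul0r x0.
(* The last cell is closed on the right, the others are half-open. *)
pose b : bool := i != n.
have -> : `[0, r]%classic `&` step_index n @^-1` [set i] =
    [set` Interval (BLeft (grid n i)) (BSide b (grid n i.+1))].
  apply/seteqP; split=> x /=; rewrite !in_itv/=.
    move=> [/andP[x0 xr] xi]; rewrite -gi// xi leqnn/= /b.
    case: eqP => [->|/eqP ni]/=; first by rewrite grid_full.
    have := step_index_gt n x i.
    rewrite xi ltnn ltn_neqAle ni ilen/= => /esym/negbT.
    by rewrite -ltNge.
  move=> /andP[ix xi].
  have x0 : 0 <= x by apply: le_trans ix; exact: grid_ge0.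
  have xi' : x <= grid n i.+1 by apply: lteifW xi.
  split.
    by rewrite x0/= (le_trans xi')// grid_le.
  apply/eqP; rewrite eqn_leq gi// ix andbT leqNgt step_index_gt.
  move: xi; rewrite /b; case: eqP => [-> _|_ /= xi]; first by rewrite ltnn.
  by rewrite leNgt xi andbF.
rewrite -[mu _]/(@lebesgue_measure R _) lebesgue_measure_itv/= lte_fin gridS.
by rewrite ltrDl rn0 -EFinB addrAC subrr add0r.
Qed.

Lemma step_index_near n x : x \in `[0, r] ->
  `|grid n (step_index n x) - x| <= r / n.+1%:R.
Proof.
rewrite in_itv/= => /andP[x0 xr].
have gx : grid n (step_index n x) <= x.
  have := leqnn (step_index n x).
  case E : {1 3}(step_index n x) => [|j]; first by rewrite /grid mul0r.
  by rewrite step_index_gt => /andP[].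
rewrite ler0_norm ?subr_le0// opprB lerBlDl -gridS.
have := step_index_gt n x (step_index n x); rewrite ltnn => /esym/negbT.
rewrite negb_and -leqNgt => /orP[nle|]; last by rewrite -ltNge => /ltW.
have /eqP -> : step_index n x == n by rewrite eqn_leq nle geq_minl.
by rewrite grid_full.
Qed.

Definition step_fun n phi : R -> X := (phi \o grid n) \o step_index n.

Lemma simple_step_fun n phi : simple_fun (step_fun n phi).
Proof. exact/simple_fun_index/finitely_valued_step_index. Qed.

Definition riemann_mean phi n : X :=
  toF n.+1%:R^-1 *: \sum_(i < n.+1) phi (grid n i).

Lemma simple_integral_step n phi :
  simple_integral 0 r (step_fun n phi) = toF r *: riemann_mean phi n.
Proof.
have fvi := finitely_valued_step_index n.
rewrite simple_integral_index// -fsbig_finite; last exact: fvi.1.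
rewrite range_step_index -fsbig_ord /riemann_mean scalerA -toScalarM scaler_sumr.
by apply: eq_bigr => i _; rewrite segment_measure_step// -ltnS.
Qed.

Lemma step_fun_unif phi : {within `[0, r], continuous phi} ->
  forall e : R, 0 < e -> exists N, forall n, (N <= n)%N -> forall x, x \in `[0, r] ->
    rnorm (phi x - step_fun n phi x) <= e.
Proof.
move=> phic e e0; have [d d0 H] := segment_unif_continuous phic e0.
have [N HN] : exists N, r / d < N%:R.
  by exists (Num.truncn (r / d)).+1; rewrite -truncn_le_nat.
exists N => n Nn x x0r; apply/ltW/H => //.
  rewrite in_itv/= grid_ge0 grid_le//.
  exact: leq_trans (geq_minl _ _) (leqnSn _).
rewrite distrC (le_lt_trans (step_index_near n x0r))//.
rewrite ltr_pdivrMr// mulrC -ltr_pdivrMr// (lt_le_trans HN)// ler_nat.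
exact: leq_trans Nn _.
Qed.

Lemma bochner_approx_step phi : {within `[0, r], continuous phi} ->
  bochner_approx 0 r phi (step_fun ^~ phi).
Proof.
move=> phic; split=> [n| |]; first exact: simple_step_fun.
  apply: aeW => t t0r; apply/cvg_seq_rnormP => e e0.
  have e20 : 0 < e / 2 by rewrite divr_gt0.
  have [N HN] := step_fun_unif phic e20.
  exists N => n /HN/(_ _ t0r)/le_lt_trans; apply.
  by rewrite ltr_pdivrMr// ltr_pMr// ltr1n.
apply/cvg_ereal0P => [n|e e0].
  by apply: integral_ge0 => t _; rewrite lee_fin rnorm_ge0.
have er0 : 0 < e / r by rewrite divr_gt0.
have [N HN] := step_fun_unif phic er0; exists N => n Nn.
apply: (@le_trans _ _ (\int[mu]_(t in `[0%R, r]) (cst (e / r)%:E t))%E).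
  apply: ge0_le_integral_nonmeasurable => t t0r; first by rewrite lee_fin rnorm_ge0.
  by rewrite lee_fin HN.
by rewrite (integral_cst_segment _ (ltW r0)) subr0 divfK ?gt_eqF.
Qed.

(** The step functions on the regular grid converge uniformly to [phi].  So they
    form a Bochner approximation, their integrals, which are the Riemann sums,
    are Cauchy, and any other approximation has the same limit by
    [simple_integral_dist_le]. *)
Lemma cvg_riemann_mean phi : {within `[0, r], continuous phi} ->
  riemann_mean phi @ \oo --> toF r^-1 *: bochner_integral 0 r phi.
Proof.
move=> phic; pose S n := simple_integral 0 r (step_fun n phi).
have [l Sl] : exists l : X, S @ \oo --> l.
  suff cS : cauchy (S @ \oo) by exact: (cvg_ex _).1 (cauchy_cvg _ cS).
  apply/(@cauchy_ballP (scalarField R k)) => _ /(@pos_toScalar R k)[e e0 ->].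
  have e3 : 0 < e / (3 * r) by rewrite divr_gt0// mulr_gt0.
  have [N HN] := step_fun_unif phic e3.
  exists (S @` [set n | (N <= n)%N], S @` [set n | (N <= n)%N]).
    by split; exists N => // n Nn; exists n.
  move=> [_ _] [/= [m Nm <-] [n Nn <-]]; rewrite ballE -lte_fin.
  apply: le_lt_trans (simple_integral_dist_le (ltW r0) (simple_step_fun m phi)
    (simple_step_fun n phi) (HN n Nn)) _.
  apply: (@le_lt_trans _ _ ((\int[mu]_(t in `[0%R, r]) (cst (e / (3 * r))%:E t)) +
      (e / (3 * r) * (r - 0))%:E)%E).
    rewrite leeD2r//; apply: ge0_le_integral_nonmeasurable => t t0r.
      by rewrite lee_fin rnorm_ge0.
    by rewrite lee_fin HN.
  rewrite (integral_cst_segment _ (ltW r0)) subr0 -EFinD lte_fin.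
  rewrite invfM mulrA divfK ?gt_eqF//; lra.
have unique v : (exists2 s, bochner_approx 0 r phi s &
    simple_integral 0 r (s n) @[n --> \oo] --> v) -> v = l.
  move=> [s [ss _ sint] sv]; apply/eqP; rewrite -subr_eq0 -rnorm_eq0.
  rewrite eq_le rnorm_ge0 andbT; apply/ler_addgt0Pr => e e0; rewrite add0r.
  have e4 : 0 < e / 4 by rewrite divr_gt0.
  have e4r : 0 < e / (4 * r) by rewrite divr_gt0// mulr_gt0.
  move/cvg_ereal0P in sint.
  have [//|N1 HN1] := sint _ _ e4.
    by move=> n; apply: integral_ge0 => t _; rewrite lee_fin rnorm_ge0.
  have [N2 HN2] := step_fun_unif phic e4r.
  move/cvg_seq_rnormP : sv => /(_ _ e4)[N3 HN3].
  move/cvg_seq_rnormP : Sl => /(_ _ e4)[N4 HN4].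
  pose n := maxn (maxn N1 N2) (maxn N3 N4).
  have {HN1}h1 : (\int[mu]_(t in `[0%R, r]) (rnorm (phi t - s n t))%:E <= (e / 4)%:E)%E.
    by apply: HN1; rewrite /n !leq_max leqnn.
  have {}HN2 : forall x, x \in `[0, r] ->
      rnorm (phi x - step_fun n phi x) <= e / (4 * r).
    by apply: HN2; rewrite /n !leq_max leqnn !orbT.
  have {}HN3 : rnorm (v - simple_integral 0 r (s n)) < e / 4.
    by apply: HN3; rewrite /n !leq_max leqnn !orbT.
  have {}HN4 : rnorm (l - S n) < e / 4.
    by apply: HN4; rewrite /n !leq_max leqnn !orbT.
  have := simple_integral_dist_le (ltW r0) (ss n) (simple_step_fun n phi) HN2.
  move=> /le_trans/(_ (leeD2r _ h1)); rewrite -EFinD lee_fin subr0 -/(S n).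
  rewrite invfM mulrA divfK ?gt_eqF// => h2.
  have := ler_rdist_add (simple_integral 0 r (s n)) v l.
  have := ler_rdist_add (S n) (simple_integral 0 r (s n)) l.
  by rewrite (rdistC (S n)); lra.
have -> : bochner_integral 0 r phi = l.
  apply: unique; rewrite /bochner_integral.
  apply: (@getPex _ [set v | exists2 s, bochner_approx 0 r phi s &
    simple_integral 0 r (s n) @[n --> \oo] --> v]).
  by exists l, (step_fun ^~ phi); [exact: bochner_approx_step|].
have -> : riemann_mean phi = (fun n => toF r^-1 *: S n).
  apply/funext => n; rewrite /S simple_integral_step scalerA -toScalarM.
  by rewrite mulVf ?gt_eqF// toScalar1 scale1r.
exact: cvgZr.
Qed.

End StepFunctions.
End Riemann.

(** * Translation means of continuous functions *)

Lemma sum_ord_blocks (V : nmodType) (N M : nat) (G : nat -> V) :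
  \sum_(i < M * N) G i = \sum_(j < M) \sum_(i < N) G (j * N + i)%N.
Proof.
elim: M => [|M IH]; first by rewrite mul0n !big_ord0.
by rewrite big_ord_recr/= -IH mulSnr big_split_ord.
Qed.

Section Means.
Context {R : realType} {k : scalars} {X : completeNormedModType (scalarField R k)}.
Local Notation toF := (@toScalar R k).
Implicit Types (f : R -> X) (J : set R).

Lemma admissible_addr J t s : admissible_interval J -> J t -> 0 <= s -> J (t + s).
Proof.
case=> [[a ->]|[a ->]|-> //] /=; rewrite !in_itv/= !andbT => ta s0.
  by rewrite (le_trans ta)// lerDl.
by rewrite (lt_le_trans ta)// lerDl.
Qed.

Section FixedFunction.
Variables (J : set R) (J_itv : admissible_interval J) (f : R -> X).
Hypothesis fc : {within J, continuous f}.

Lemma translate_continuous t r : J t ->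
  {within `[0, r], continuous (fun s => f (t + s))}.
Proof.
move=> Jt; apply/within_continuous_rnormP => s.
rewrite /= in_itv/= => /andP[s0 _] e e0.
have Jts := admissible_addr J_itv Jt s0.
have /within_continuous_rnormP/(_ _ Jts e e0)[d d0 H] := fc.
exists d => // s' /=; rewrite in_itv/= => /andP[s'0 _] ss'.
apply: H; first exact: admissible_addr.
by rewrite opprD addrACA subrr add0r.
Qed.

Lemma cvg_shift_mean t r : J t -> 0 < r ->
  riemann_mean r (fun s => f (t + s)) @ \oo --> shift_mean r f t.
Proof. by move=> Jt r0; apply: cvg_riemann_mean => //; exact: translate_continuous. Qed.

(** A mean of vectors of norm at most [e] has norm at most [e].  The form with
    two base points, two coefficients and a constant [v] covers both the
    oscillation (with [c'] a second weight) and the size (with [c' = 0]) of a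
    weighted mean. *)
Lemma shift_mean_dist_le (c c' : scalarField R k) (v : X) t t' r (e : R) :
  J t -> J t' -> 0 < r ->
  (forall s, 0 <= s <= r -> rnorm (c *: f (t + s) - c' *: f (t' + s) - v) <= e) ->
  rnorm (c *: shift_mean r f t - c' *: shift_mean r f t' - v) <= e.
Proof.
move=> Jt Jt' r0 H.
pose u n := c *: riemann_mean r (fun s => f (t + s)) n -
            c' *: riemann_mean r (fun s => f (t' + s)) n - v.
apply: (@rnorm_lim_le _ _ _ u).
  by apply: cvgB; [apply: cvgB; apply: cvgZr; exact: cvg_shift_mean|exact: cvg_cst].
move=> n; rewrite /u /riemann_mean.
have -> : v = toF n.+1%:R^-1 *: \sum_(i < n.+1) v.
  rewrite sumr_const card_ord -[v *+ _]scaler_nat scalerA -toScalar_nat -toScalarM.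
  by rewrite mulVf ?pnatr_eq0// toScalar1 scale1r.
rewrite !(scalerA _ (toF _)) ![_ * toF _]mulrC -!scalerA -!scalerBr !scaler_sumr -!sumrB.
rewrite rnormZr ger0_norm ?invr_ge0// ler_pdivrMl ?ltr0n// mulr_natl.
apply: le_trans (rnorm_sum _ _ _) _.
rewrite -[X in _ <= e *+ X]card_ord -sumr_const; apply: ler_sum => i _.
by apply: H; rewrite grid_ge0//= grid_le// ltnW// ltn_ord.
Qed.

(** The regular grid with [m.+1 * n.+1] cells on [[0, m.+1 * r]] is the union of
    [m.+1] translates of the grid with [n.+1] cells on [[0, r]]; let [n] tend to
    infinity in the resulting identity between Riemann sums. *)
Lemma shift_mean_split (m : nat) (r t : R) : J t -> 0 < r ->
  shift_mean (m.+1%:R * r) f t =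
  toF m.+1%:R^-1 *: \sum_(j < m.+1) shift_mean r f (t + j%:R * r).
Proof.
move=> Jt r0; (* [riemann_mean _ n] uses [n.+1] cells. *)
pose idx n := (m.+1 * n.+1).-1.
have mr0 : 0 < m.+1%:R * r by rewrite mulr_gt0.
have c1 : riemann_mean (m.+1%:R * r) (fun s => f (t + s)) (idx n) @[n --> \oo]
    --> shift_mean (m.+1%:R * r) f t.
  apply: cvg_comp (cvg_shift_mean Jt mr0).
  move=> A [N _ HN]; exists N => // n /= Nn; apply: HN => /=.
  by rewrite /idx mulnS/= (leq_trans Nn)// (leq_trans _ (leq_addl _ _))// leq_pmull.
have c2 : toF m.+1%:R^-1 *: (\sum_(j < m.+1)
      riemann_mean r (fun s => f (t + j%:R * r + s)) n) @[n --> \oo]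
    --> toF m.+1%:R^-1 *: \sum_(j < m.+1) shift_mean r f (t + j%:R * r).
  apply: cvgZr; apply: cvg_big => [|j _]; first exact: add_continuous.
  apply: cvg_shift_mean => //.
  by apply: admissible_addr => //; rewrite mulr_ge0// ltW.
apply: cvg_unique c1 _ => //.
rewrite (_ : (fun n => _) = (fun n => toF m.+1%:R^-1 *: (\sum_(j < m.+1)
      riemann_mean r (fun s => f (t + j%:R * r + s)) n)))//.
apply/funext => n; rewrite /riemann_mean -scaler_sumr scalerA -toScalarM.
have E : (idx n).+1 = (m.+1 * n.+1)%N by [].
rewrite E -invfM -natrM; congr (_ *: _).
rewrite (sum_ord_blocks n.+1 m.+1 (fun i => f (t + grid (m.+1%:R * r) (idx n) i))).
apply: eq_bigr => j _; apply: eq_bigr => i _; congr f; rewrite -addrA; congr (_ + _).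
rewrite /grid E natrD !natrM.
have n0 : n.+1%:R != 0 :> R by rewrite pnatr_eq0.
have m0 : m.+1%:R != 0 :> R by rewrite pnatr_eq0.
by field; rewrite !(addrC 1) !natr1 n0 m0.
Qed.

End FixedFunction.

Lemma shift_mean_shift_diff J f a r t :
  admissible_interval J -> {within J, continuous f} -> J t -> 0 <= a -> 0 < r ->
  shift_mean r (shift_diff a f) t = shift_mean r f (t + a) - shift_mean r f t.
Proof.
move=> J_itv fc Jt a0 r0.
have fac : {within J, continuous (shift_diff a f)}.
  apply/within_continuous_rnormP => s Js e e0.
  have e20 : 0 < e / 2 by rewrite divr_gt0.
  have /within_continuous_rnormP H := fc.
  have [d1 d10 H1] := H s Js _ e20.
  have [d2 d20 H2] := H _ (admissible_addr J_itv Js a0) _ e20.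
  exists (Num.min d1 d2); first by rewrite lt_min d10.
  move=> s' Js'; rewrite lt_min => /andP[sd1 sd2].
  have h1 := H1 _ Js' sd1.
  have h2 : rnorm (f (s + a) - f (s' + a)) < e / 2.
    apply: H2; first exact: admissible_addr.
    by rewrite opprD addrACA subrr addr0.
  rewrite /shift_diff opprD addrACA -opprD.
  apply: le_lt_trans (ler_rnormB _ _) _.
  by rewrite (splitr e) ltrD.
have Jta := admissible_addr J_itv Jt a0.
have c1 := cvg_shift_mean J_itv fac Jt r0.
have c2 := cvgB (cvg_shift_mean J_itv fc Jta r0) (cvg_shift_mean J_itv fc Jt r0).
apply: cvg_unique c1 _ => //.
suff -> : riemann_mean r (fun s => shift_diff a f (t + s)) = (fun n =>
  riemann_mean r (fun s => f (t + a + s)) n - riemann_mean r (fun s => f (t + s)) n).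
  exact: c2.
apply/funext => n; rewrite /riemann_mean -scalerBr -sumrB; congr (_ *: _).
by apply: eq_bigr => i _; rewrite /shift_diff addrAC.
Qed.

End Means.

(** * Continuity of locally integrable functions with continuous differences *)

Section LebesgueTranslation.
Context {R : realType}.
Local Notation borR := (measurableTypeR R).
Local Notation lambda := (@lebesgue_measure R).
Local Notation lebR := (caratheodory_type (@wlength R idfun)^*%mu).
Local Notation mu := (@completed_lebesgue_measure R).

Lemma measurable_translation (c : R) :
  measurable_fun setT ((fun x => x + c) : borR -> borR).
Proof. exact: measurable_funD. Qed.

(** Both sides are measures in [A] and agree on intervals. *)
Lemma lebesgue_measure_translation (c : R) (A : set borR) : measurable A ->
  lambda ((fun x => x + c) @^-1` A) = lambda A.
Proof.
move=> mA; apply/esym.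
have H : forall B : set R, ocitv B ->
    lambda B = pushforward lambda ((fun x => x + c) : borR -> borR) B.
  move=> _ [[a b] _ <-]; rewrite /pushforward.
  rewrite (_ : _ @^-1` _ = `]a - c, b - c]%classic); last first.
    by apply/seteqP; split=> x /=; rewrite !in_itv/= ltrBlDr lerBrDr.
  rewrite !lebesgue_measure_itv/= !lte_fin ltrD2r; case: ifP => // _.
  by rewrite -!EFinB opprD addrACA subrr addr0.
pose nu := measure_function_pushforward__canonical__measure_function_Measure
  lambda (measurable_translation c).
exact: (@lebesgue_measure_unique R nu H A mA).
Qed.

Lemma compact_sub_open (K U : set R) : compact K -> open U -> K `<=` U ->
  exists2 d : R, 0 < d & forall x y, K x -> `|x - y| < d -> U y.
Proof.
move=> cK oU KU; apply: (@compact_lebesgue_number R K (fun=> U)) => // x /KU Ux.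
have /nbhs_ballP[d /= d0 H] := open_nbhs_nbhs (conj oU Ux).
by exists d => // x' y _ _; exact: H.
Qed.

Lemma compact_borel (K : set R) : compact K -> measurable (K : set borR).
Proof. by move=> cK; apply: closed_measurable; exact: compact_closed. Qed.

(** If [U] is an open set containing [K] of measure less than [3/2] that of [K],
    the small translates of [K] stay in [U] and have the measure of [K], so they
    miss at most half of [K].  If every point of [K] eventually left [K] under
    the translations [sigma m], the sets [D n] of points of [K] that have left
    for good at time [n] would increase to [K] while having at most half its
    measure. *)
Lemma compact_translation_recurrent (K : set R) (sigma : nat -> R) :
  compact K -> lambda K != 0%E -> sigma @ \oo --> 0 ->
  exists2 x, K x & forall n, exists2 m, (n <= m)%N & K (x + sigma m).
Proof.
move=> cK K0 sigma0; have mK := compact_borel cK.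
have Koo : (lambda K < +oo)%E by exact: compact_finite_measure.
have Kfin : lambda K = (fine (lambda K))%:E by rewrite fineK// ge0_fin_numE.
set e := fine (lambda K) in Kfin.
have e0 : 0 < e by rewrite -lte_fin -Kfin lt0e K0 measure_ge0.
have e20 : 0 < e / 2 by rewrite divr_gt0.
have [U [oU KU mUK]] := lebesgue_regularity_outer mK Koo e20.
have mU : measurable (U : set borR) by exact: open_measurable.
have Uoo : (lambda U < +oo)%E.
  apply: (@le_lt_trans _ _ (lambda K + lambda (U `\` K))%E).
    by rewrite -[in leLHS](setDUK KU); apply: measureU2 => //; exact: measurableD.
  by rewrite lte_add_pinfty// (lt_trans mUK)// ltry.
have [d d0 dU] := compact_sub_open cK oU KU.
pose T m : set borR := (fun x => x + sigma m) @^-1` K.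
have mT m : measurable (T m).
  by rewrite -[T m]setTI; exact: measurable_translation.
have [N HN] : exists N, forall m, (N <= m)%N -> (lambda (K `\` T m) <= (e / 2)%:E)%E.
  move/cvgrPdist_lt : sigma0 => /(_ d d0)[N _ HN]; exists N => m /HN/=.
  rewrite sub0r normrN => sd.
  have TU : T m `<=` U.
    by move=> x Kx; apply: dU Kx _; rewrite addrAC subrr add0r.
  apply: (@le_trans _ _ (lambda (U `\` T m))).
    apply: le_measure; rewrite ?mem_set//; [exact: measurableD..|].
    exact: setSD.
  have TK : lambda (T m) = lambda K by exact: lebesgue_measure_translation.
  rewrite measureD// setIidr//.
  have := ltW mUK; rewrite measureD// setIidr// => UK.
  by suff : (lambda U - lambda (T m) <= (e / 2)%:E)%E by []; rewrite TK.
apply: contrapT => /forall2NP H.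
pose D n := K `&` [set x | forall m, (n <= m)%N -> ~ K (x + sigma m)].
have DE n : D n = \bigcap_(m in [set m | (n <= m)%N]) (K `\` T m).
  apply/seteqP; split=> [x [Kx nK] m /= nm|x Dx].
    by split=> //; exact: nK.
  by split=> [|m nm]; [have [] := Dx n (leqnn n)|have [] := Dx m nm].
have mD n : measurable (D n : set borR).
  by rewrite DE; apply: bigcap_measurable => [|m _]; [by exists n => /=|
    exact: measurableD].
have KD : K = \bigcup_n D n.
  apply/seteqP; split=> [x Kx|x [n _ []]//].
  have [//|/existsNP[n nH]] := H x; exists n => //; split=> // m nm Km.
  by apply: nH; exists m.
have := @nondecreasing_cvg_mu _ borR R lambda D mD.
rewrite -KD => /(_ mK) Dcvg.
have {}Dcvg : (lambda \o D) x @[x --> \oo] --> lambda K.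
  apply: Dcvg => n m nm; apply/subsetPset => x [Kx Dx]; split=> // p mp.
  by apply: Dx; exact: leq_trans mp.
have : (lambda K <= (e / 2)%:E)%E.
  rewrite -(cvg_lim _ Dcvg)//; apply: lime_le; first by apply/cvg_ex; exists (lambda K).
  exists 0%N => // n _ /=; apply: le_trans (HN (maxn n N) (leq_maxr _ _)).
  apply: le_measure; rewrite ?mem_set//; first exact: measurableD.
  by rewrite DE; apply: bigcap_inf; rewrite /= leq_maxl.
rewrite Kfin lee_fin; lra.
Qed.

(** A Lebesgue measurable set is a Borel set up to a null set, and Borel sets are
    inner regular. *)
Lemma lebesgue_inner_compact (P : set lebR) : measurable P -> mu P != 0%E ->
  (mu P < +oo)%E -> exists K : set R, [/\ compact K, K `<=` P & lambda K != 0%E].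
Proof.
rewrite -[measurable]completed_caratheodory_measurable.
rewrite g_sigma_completed_algebra_genE => -[A mA [N negN AN]] P0 Poo.
have PA : mu P = lambda A.
  apply/eqP; rewrite eq_le -AN; apply/andP; split; last first.
    by apply: le_outer_measure; exact: subsetUl.
  apply: le_trans (outer_measureU2 _ _ _) _.
  have N0 : mu N = 0%E := (negligible_outer_measure N).1 negN.
  by suff : (lambda A + mu N <= lambda A)%E by []; rewrite N0 adde0.
rewrite PA in P0 Poo.
have Afin : lambda A = (fine (lambda A))%:E by rewrite fineK// ge0_fin_numE.
have e0 : 0 < fine (lambda A).
  by rewrite -lte_fin -Afin lt0e P0 measure_ge0.
have [K [cK KA mAK]] := lebesgue_regularity_inner mA Poo e0.
exists K; split=> //; first by rewrite -AN; apply: subset_trans KA _; exact: subsetUl.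
apply/eqP => K0; move: mAK; rewrite -Afin measureD//; last exact: compact_borel.
rewrite setIidr// => AK.
have : (lambda A - lambda K < lambda A)%E by [].
by rewrite K0 sube0 ltxx.
Qed.

End LebesgueTranslation.

Section DeBruijn.
Context {R : realType} {k : scalars} {X : completeNormedModType (scalarField R k)}.
Local Notation lebR := (caratheodory_type (@wlength R idfun)^*%mu).
Local Notation mu := (@completed_lebesgue_measure R).
Local Notation lambda := (@lebesgue_measure R).

Lemma measurable_simple_dist_le (s s' : R -> X) (e : R) :
  simple_fun s -> simple_fun s' ->
  measurable ([set t | rnorm (s t - s' t) <= e] : set lebR).
Proof.
move=> ss ss'; have fvi := finitely_valued_pair ss ss'.
exact: (measurable_index_preimage [set p | rnorm (p.1 - p.2) <= e] fvi).
Qed.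

(** Almost every [x] belongs to one of the sets [C n] on which the later
    approximants stay within [e] of [s n], so some [C n] is not null; [s n] takes
    finitely many values, so one of its fibers in [C n] is not null. *)
Lemma bochner_nearly_constant (a b e : R) (f : R -> X) (s : nat -> R -> X) :
  a < b -> 0 < e -> bochner_approx a b f s ->
  exists (P : set lebR) (v : X), [/\ measurable P, P `<=` `[a, b]%classic,
    mu P != 0%E & forall x, P x -> rnorm (f x - v) <= e].
Proof.
move=> ab e0 [ss [N [mN N0 sN]] _].
have mI : measurable (`[a, b]%classic : set lebR).
  by apply: borel_lebesgue; exact: measurable_itv.
pose C n : set lebR := \bigcap_(m in [set m | (n <= m)%N])
  [set t | rnorm (s m t - s n t) <= e].
have mC n : measurable (C n).
  apply: bigcap_measurable => [|m _]; first by exists n => /=.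
  exact: measurable_simple_dist_le.
have Cf n x : x \in `[a, b] -> ~ N x -> C n x -> rnorm (f x - s n x) <= e.
  move=> xab Nx Cx; have /cvg_seq_rnormP sx : s m x @[m --> \oo] --> f x.
    by apply: contrapT => nsx; apply: Nx; apply: sN => /= H; exact/nsx/H.
  apply/ler_addgt0Pl => d /sx[M HM].
  apply: le_trans (ler_rdist_add (s (maxn n M) x) _ _) _.
  apply: lerD; first by apply/ltW/HM; exact: leq_maxr.
  by apply: (Cx (maxn n M)); rewrite /= leq_maxl.
have [n Cn] : exists n, segment_measure a b (C n) != 0.
  apply: contrapT => /forallNP C0.
  suff : mu.-negligible (`[a, b]%classic : set lebR).
    move/(negligibleP _ mI) => ab0.
    have : mu `[a, b]%classic = (b - a)%:E by apply: completed_measure_itv; exact: ltW.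
    rewrite ab0 => -[] h0; move: ab; rewrite -subr_gt0 -h0 ltxx//.
  apply: (@negligibleS _ _ _ _ (N `|` \bigcup_n (`[a, b]%classic `&` C n))).
    move=> x xab; have [Nx|Nx] := pselect (N x); [by left|right].
    have /cvg_seq_rnormP sx : s m x @[m --> \oo] --> f x.
      by apply: contrapT => nsx; apply: Nx; apply: sN => /= H; exact/nsx/H.
    have e20 : 0 < e / 2 by rewrite divr_gt0.
    have [M HM] := sx _ e20; exists M => //; split=> // m /= Mm.
    apply: le_trans (ler_rdist_add (f x) _ _) _.
    by rewrite (splitr e) lerD// ltW// ?HM// rdistC HM.
  apply: negligibleU; first exact/negligibleP.
  apply: negligible_bigcup => n; apply/negligibleP; first exact: measurableI.
  have Cn0 : segment_measure a b (C n) = 0 by apply/eqP/negP => /negP; exact: C0.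
  by rewrite -[RHS]/(0%R%:E) -Cn0; exact: fin_segment_measure.
have [v Cv] : exists v, segment_measure a b (C n `&` s n @^-1` [set v]) != 0.
  apply: contrapT => /forallNP v0; move/eqP : Cn; apply.
  rewrite (segment_measure_fibers a b (ss n) (mC n)) big1// => v _.
  by apply/eqP/negP => /negP; exact: v0.
have mCv : measurable (C n `&` s n @^-1` [set v]).
  by apply: measurableI => //; have [] := ss n.
exists ((`[a, b]%classic `&` (C n `&` s n @^-1` [set v])) `\` N), v; split.
- by apply: measurableD => //; exact: measurableI.
- by move=> x [[]].
- apply/eqP => P0; move/eqP : Cv; apply; apply: EFin_inj.
  have mICv := measurableI _ _ mI mCv.
  suff nICv : mu.-negligible (`[a, b]%classic `&` (C n `&` s n @^-1` [set v])).
    by rewrite -fin_segment_measure//; apply/(negligibleP _ mICv).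
  pose Q : set lebR := `[a, b]%classic `&` (C n `&` s n @^-1` [set v]).
  apply: (@negligibleS _ _ _ _ ((Q `\` N) `|` N)).
    by move=> x Ax; have [Nx|Nx] := pselect (N x); [right|left].
  apply: negligibleU; last exact/negligibleP.
  by apply/negligibleP => //; exact: measurableD.
- by move=> x [[xab [Cx /= <-]] Nx]; exact: Cf.
Qed.

(** If [f] is not continuous at [t], choose [tau n] tending to [t] with
    [f (tau n)] far from [f t], and [K] compact of positive measure on which [f]
    is nearly constant.  With [x] in [K] returning to [K] under the translations
    by [tau n - t], the identity
    [f t - f (tau n) = (f x - f (x + (tau n - t)))
      - (Delta_(x - t) f t - Delta_(x - t) f (tau n))]
    has a small right-hand side for infinitely many [n].  The set [K] is taken
    to the right of [t + 1], so that [x - t > 0]. *)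
Lemma L1loc_shift_diff_continuous (J : set R) (f : R -> X) :
  admissible_interval J -> L1loc J f ->
  (forall a : R, 0 < a -> {within J, continuous (shift_diff a f)}) ->
  {within J, continuous f}.
Proof.
move=> J_itv fL fD; apply/within_continuous_rnormP => t Jt e e0.
apply: contrapT => nd.
have far (n : nat) : exists t',
    [/\ J t', `|t - t'| < n.+1%:R^-1 & e <= rnorm (f t - f t')].
  apply: contrapT => /forallNP nt'; apply: nd; exists n.+1%:R^-1 => // t' Jt' tt'.
  by rewrite ltNge; apply/negP => et'; exact: (nt' t').
have [tau Htau] := choice far.
have [s fs] : bochner_integrable (t + 1) (t + 2) f.
  apply: fL => [|x /=]; first by rewrite lerD2l ler1n.
  rewrite in_itv/= => /andP[tx _]; rewrite -(subrK t x) addrC.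
  by apply: admissible_addr => //; lra.
have e40 : 0 < e / 4 by rewrite divr_gt0.
have t12 : t + 1 < t + 2 by rewrite ltrD2l ltr1n.
have [P [v [mP Psub P0 Pv]]] := bochner_nearly_constant t12 e40 fs.
have Poo : (mu P < +oo)%E.
  apply: (@le_lt_trans _ _ (mu `[t + 1, t + 2]%classic)).
    apply: le_measure; rewrite ?mem_set//.
    by apply: borel_lebesgue; exact: measurable_itv.
  have -> : mu `[t + 1, t + 2]%classic = (t + 2 - (t + 1))%:E.
    by apply: completed_measure_itv; exact: ltW.
  exact: ltry.
have [K [cK KP K0]] := lebesgue_inner_compact mP P0 Poo.
have sigma0 : (fun n => tau n - t) @ \oo --> 0.
  apply/cvgrPdist_lt => d d0.
  have [N _ HN] := near_infty_natSinv_lt (PosNum d0).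
  exists N => // n /= Nn; have [_ tn _] := Htau n.
  by rewrite sub0r opprB (lt_trans tn)//; exact: HN.
have [x Kx xrec] := compact_translation_recurrent cK K0 sigma0.
have x1 : 0 < x - t.
  by have := Psub _ (KP _ Kx); rewrite /= in_itv/= => /andP[+ _]; lra.
have /within_continuous_rnormP/(_ _ Jt _ e40)[d d0 Hd] := fD _ x1.
have [N _ HN] := near_infty_natSinv_lt (PosNum d0).
have [n Nn Kn] := xrec N.
have [Jn tn en] := Htau n.
have {}tn : `|t - tau n| < d by apply: lt_trans tn _; exact: HN.
have h1 := Hd _ Jn tn.
have h2 := Pv _ (KP _ Kx).
have h3 := Pv _ (KP _ Kn).
have h4 : rnorm (f x - f (x + (tau n - t))) <= e / 2.
  apply: le_trans (ler_rdist_add v _ _) _; rewrite [in X in _ + X]rdistC; lra.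
have : rnorm (f t - f (tau n)) <= rnorm (f x - f (x + (tau n - t))) +
    rnorm (shift_diff (x - t) f t - shift_diff (x - t) f (tau n)).
  apply: le_trans (ler_rnormB _ _); rewrite le_eqVlt; apply/orP; left.
  apply/eqP; congr rnorm.
  have alg (p q u w : X) : p - q = (u - w) - ((u - p) - (w - q)).
    by rewrite !opprB [RHS]addrA subrKA [RHS]addrC subrKA.
  by rewrite /shift_diff (addrC t (x - t)) subrK (addrCA (tau n)) -alg.
lra.
Qed.

End DeBruijn.

(** * Weighted uniformly continuous functions and the difference property *)

Section WeightedSpaces.
Context {R : realType} {k : scalars} {X : completeNormedModType (scalarField R k)}.
Local Notation toF := (@toScalar R k).
Implicit Types (f g u : R -> X) (J : set R).

(** [UCif false] is [UC] and [UCif true] is [BUC]; both parts of the theorem are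
    proved at once. *)
Definition UCif (bd : bool) J : set (R -> X) :=
  [set f | UC X J f /\ (bd -> [bounded f t | t in J])].

Section Closure.
Variables (bd : bool) (J : set R).

(** Membership up to an error of arbitrarily small oscillation is membership.
    The error need not be uniformly small, which matters here: the error terms
    of the main proof are averages of functions [g_s] that oscillate little but
    need not be small. *)
Lemma UCif_approx u :
  (forall e : R, 0 < e -> exists g b : R -> X, [/\ UCif bd J g,
    forall t, J t -> u t = g t + b t,
    exists2 d : R, 0 < d & forall t t', J t -> J t' -> `|t - t'| < d ->
      rnorm (b t - b t') <= e &
    bd -> exists M : R, forall t, J t -> rnorm (b t) <= M]) ->
  UCif bd J u.
Proof.
move=> H; split.
  apply/UC_rnormP => e e0; have e20 : 0 < e / 2 by rewrite divr_gt0.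
  have [g [b [[/UC_rnormP/(_ _ e20)[d1 d10 H1] _] ugb [d2 d20 H2] _]]] := H _ e20.
  exists (Num.min d1 d2); first by rewrite lt_min d10.
  move=> t t' Jt Jt'; rewrite lt_min => /andP[td1 td2].
  rewrite !ugb// opprD addrACA; apply: le_lt_trans (ler_rnormD _ _) _.
  by rewrite (splitr e) ltr_leD// ?H1 ?H2.
move=> bdT; have [g [b [Ug ugb _ /(_ bdT)[M2 HM2]]]] := H 1 ltr01.
have /bounded_rnormP[M1 HM1] := Ug.2 bdT.
apply/bounded_rnormP; exists (M1 + M2) => t Jt.
by rewrite ugb//; apply: le_trans (ler_rnormD _ _) _; rewrite lerD ?HM1 ?HM2.
Qed.

Lemma UCif_ext f g : (forall t, J t -> g t = f t) -> UCif bd J f -> UCif bd J g.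
Proof.
move=> gf Uf; apply: UCif_approx => e e0; exists f, (fun=> 0); split=> //.
- by move=> t Jt; rewrite gf// addr0.
- by exists 1 => // *; rewrite subrr rnorm0 ltW.
- by move=> _; exists 0 => *; rewrite rnorm0.
Qed.

Lemma UCif0 : UCif bd J (fun=> 0).
Proof.
split; first by apply/UC_rnormP => e e0; exists 1 => // *; rewrite subrr rnorm0.
by move=> _; apply/bounded_rnormP; exists 0 => *; rewrite rnorm0.
Qed.

Lemma UCifD f g : UCif bd J f -> UCif bd J g -> UCif bd J (fun t => f t + g t).
Proof.
move=> Uf [/UC_rnormP Ug gbd]; apply: UCif_approx => e e0.
exists f, g; split=> //.
  have [d d0 H] := Ug e e0; exists d => // t t' Jt Jt' tt'.
  by rewrite ltW// H.
by move=> /gbd/bounded_rnormP.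
Qed.

Lemma UCifZ (c : R) f : UCif bd J f -> UCif bd J (fun t => toF c *: f t).
Proof.
move=> [/UC_rnormP Uf fbd]; split.
  apply/UC_rnormP => e e0; have c1 : 0 < `|c| + 1 by rewrite ltr_wpDl.
  have ec0 : 0 < e / (`|c| + 1) by rewrite divr_gt0.
  have [d d0 H] := Uf _ ec0; exists d => // t t' Jt Jt' tt'.
  rewrite -scalerBr rnormZr; have := H t t' Jt Jt' tt'.
  rewrite ltr_pdivlMr// mulrC; apply: le_lt_trans.
  by rewrite ler_wpM2r ?rnorm_ge0// lerDl.
move=> /fbd/bounded_rnormP[M HM]; apply/bounded_rnormP; exists (`|c| * M) => t Jt.
by rewrite rnormZr ler_wpM2l// HM.
Qed.

Lemma UCif_sum (I : Type) (r : seq I) (F : I -> R -> X) :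
  (forall i, UCif bd J (F i)) -> UCif bd J (fun t => \sum_(i <- r) F i t).
Proof.
move=> UF; elim: r => [|i r IH].
  by apply: UCif_ext UCif0 => t _; rewrite big_nil.
by apply: UCif_ext (UCifD (UF i) IH) => t _; rewrite big_cons.
Qed.

Lemma UCif_continuous f : UCif bd J f -> {within J, continuous f}.
Proof.
move=> [/UC_rnormP Uf _]; apply/within_continuous_rnormP => t Jt e /Uf[d d0 H].
by exists d => // t' Jt' tt'; exact: H.
Qed.

Variables (gamma : R -> scalarField R k) (gamma_neq0 : forall t, J t -> gamma t != 0).

Lemma weighted_UCifP u :
  weighted J gamma (UCif bd J) u <-> UCif bd J (fun t => (gamma t)^-1 *: u t).
Proof.
split=> [[f Uf uf]|Uu].
  by apply: UCif_ext Uf => t Jt; rewrite uf// scalerA mulVf ?gamma_neq0// scale1r.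
exists (fun t => (gamma t)^-1 *: u t) => // t Jt.
by rewrite scalerA divff ?gamma_neq0// scale1r.
Qed.

Lemma weighted_continuous u : {within J, continuous gamma} ->
  weighted J gamma (UCif bd J) u -> {within J, continuous u}.
Proof.
move=> gc [f Uf uf].
have : {within J, continuous (fun t => gamma t *: f t)}.
  by move=> t; apply: cvgZ; [exact: gc|exact: (UCif_continuous Uf)].
by apply: subspace_eq_continuous => t /set_mem Jt; rewrite /from_subspace/= uf.
Qed.

End Closure.

Section Baire.
Variables (bd : bool) (J : set R) (J_itv : admissible_interval J).
Variables (q : R -> scalarField R k) (f : R -> X).
Hypothesis fc : {within J, continuous f}.
Hypothesis Uf : forall a : R, 0 < a -> UCif bd J (fun t => q t *: shift_diff a f t).

Lemma shift_abs_continuous t : J t -> continuous (fun s : R => q t *: shift_diff `|s| f t).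
Proof.
move=> Jt s; rewrite /shift_diff; apply: cvgZr; apply: cvgB; last exact: cvg_cst.
have Jts := admissible_addr J_itv Jt (normr_ge0 s).
apply/cvg_rnormP => e e0; have /within_continuous_rnormP/(_ _ Jts _ e0)[d d0 H] := fc.
apply/nbhs_ballP; exists d => // s' /= ss'; apply: H.
  exact: admissible_addr.
by rewrite opprD addrACA subrr add0r (le_lt_trans (ler_dist_dist _ _)).
Qed.

(** Baire's theorem on the line.  Differences are indexed by [`|s|] so that the
    closed sets [E n] cover all of [R] and are symmetric; a ball inside [E n] may
    then be centered at a nonnegative point, and its right half avoids 0. *)
Lemma equicontinuous_on_interval (e : R) : 0 < e ->
  exists c d, [/\ 0 < c, c < d &
    exists del M : R, 0 < del /\ forall s, c <= s <= d ->
      (forall t t', J t -> J t' -> `|t - t'| < del ->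
        rnorm (q t *: shift_diff s f t - q t' *: shift_diff s f t') <= e) /\
      (bd -> forall t, J t -> rnorm (q t *: shift_diff s f t) <= M)].
Proof.
move=> e0; pose E (n : nat) := [set s : R |
  (forall t t', J t -> J t' -> `|t - t'| < n.+1%:R^-1 ->
     rnorm (q t *: shift_diff `|s| f t - q t' *: shift_diff `|s| f t') <= e) /\
  (bd -> forall t, J t -> rnorm (q t *: shift_diff `|s| f t) <= n%:R)].
have cE n : closed (E n).
  move=> s cEs; split=> [t t' Jt Jt' tt'|bdT t Jt].
    have cl : closed [set s : R | rnorm (q t *: shift_diff `|s| f t -
        q t' *: shift_diff `|s| f t') <= e].
      apply: (@closed_rnorm_le _ _ _ (fun s => q t *: shift_diff `|s| f t -
        q t' *: shift_diff `|s| f t')) => y.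
      by apply: cvgB; exact: shift_abs_continuous.
    by apply: cl; apply: closure_subset cEs => y [/(_ t t' Jt Jt' tt')].
  have cl : closed [set s : R | rnorm (q t *: shift_diff `|s| f t) <= n%:R].
    apply: (@closed_rnorm_le _ _ _ (fun s => q t *: shift_diff `|s| f t)).
    exact: shift_abs_continuous.
  by apply: cl; apply: closure_subset cEs => y [_ /(_ bdT t Jt)].
have Ecover s : exists n, E n s.
  have [U Ubd] : UCif bd J (fun t => q t *: shift_diff `|s| f t).
    have [->|s0] := eqVneq s 0; last by apply: Uf; rewrite normr_gt0.
    apply: UCif_ext (UCif0 bd J) => t _.
    by rewrite normr0 /shift_diff addr0 subrr scaler0.
  move/UC_rnormP : U => /(_ e e0)[d d0 Hd].
  have [M HM] : exists M : R, bd -> forall t, J t ->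
      rnorm (q t *: shift_diff `|s| f t) <= M.
    have [bdT|_] := boolP bd; last by exists 0.
    by have /bounded_rnormP[M HM] := Ubd bdT; exists M.
  pose n := maxn (Num.truncn d^-1) (Num.truncn M).+1; exists n; split.
    move=> t t' Jt Jt' tt'; apply/ltW/Hd => //; apply: lt_trans tt' _.
    rewrite invf_plt ?posrE// -truncn_le_nat; exact: leq_maxl.
  move=> bdT t Jt; apply: le_trans (HM bdT t Jt) _; apply: ltW.
  have : (Num.truncn M < n)%N by exact: leq_maxr.
  by case: (n) => // j; rewrite ltnS truncn_le_nat.
have [n [s0 [r0 r00 sE]]] : exists n s0, exists2 r : R, 0 < r & ball s0 r `<=` E n.
  apply: contrapT => nE.
  have dE n : open (~` E n) /\ dense (~` E n).
    split; first exact: closed_openC.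
    move=> O [x Ox] oO; apply: contrapT => /nonemptyPn OE; apply: nE.
    have /nbhs_ballP[r /= r0 rO] := open_nbhs_nbhs (conj oO Ox).
    exists n, x, r => // y /rO Oy; apply: contrapT => nEy.
    by have : (O `&` ~` E n) y by []; rewrite OE.
  have [//|x [_ nx]] := @Baire R R _ dE setT _ openT; first by exists 0.
  by have [n Ex] := Ecover x; exact: (nx n).
have sE' y : `| `|s0| - y| < r0 -> E n y.
  have [s0p|s0n] := leP 0 s0; first by rewrite (ger0_norm s0p) => ?; exact: sE.
  rewrite (ltr0_norm s0n) => yr; have : E n (- y).
    by apply: sE; rewrite /ball/= opprK -normrN opprD.
  by rewrite /E/= normrN.
exists (`|s0| + r0 / 4), (`|s0| + r0 / 2); split.
- by rewrite ltr_wpDl// divr_gt0.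
- by rewrite ltrD2l; lra.
exists n.+1%:R^-1, n%:R; split=> // s /andP[s0s ss0].
have sp : 0 <= s by apply: le_trans s0s; rewrite addr_ge0// divr_ge0// ltW.
suff : E n s by rewrite /E/= ger0_norm.
by apply: sE'; rewrite ltr_norml; lra.
Qed.

End Baire.

(** The step [r] is less than half of [d - c] and [p] is the first integer with
    [p r > c], so that [p r + s] stays in [[c, d]] for [0 <= s <= r].  With the
    weight [q = gamma^-1], the term [q (f - M_r f (. + p r))] is the only one
    that is not already in the space, and Baire's interval bounds its
    oscillation by [e]. *)
Lemma weighted_UCif_DeltaProp (bd : bool) (J : set R)
    (gamma : R -> scalarField R k) :
  admissible_interval J -> {within J, continuous gamma} ->
  (forall t, J t -> gamma t != 0) ->
  weighted J gamma (UCif bd J) `<=` mean_ext J (weighted J gamma (UCif bd J)) ->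
  DeltaProp J (weighted J gamma (UCif bd J)).
Proof.
move=> J_itv gc g0 Mhyp f fL fD h h0.
have fc : {within J, continuous f}.
  apply: L1loc_shift_diff_continuous => // a a0.
  exact: weighted_continuous (fD a a0).
pose q t := (gamma t)^-1.
have qD a : 0 < a -> UCif bd J (fun t => q t *: shift_diff a f t).
  by move=> a0; apply/weighted_UCifP => //; exact: fD.
have qMD r a : 0 < r -> 0 <= a ->
    UCif bd J (fun t => q t *: shift_mean r (shift_diff a f) t).
  move=> r0; rewrite le_eqVlt => /predU1P[<-|a0].
    apply: UCif_ext (UCif0 bd J) => t Jt.
    by rewrite (shift_mean_shift_diff J_itv fc)// addr0 subrr scaler0.
  apply/weighted_UCifP => //; have [_] := Mhyp _ (fD a a0); exact.
apply/weighted_UCifP => //; apply: UCif_approx => e e0.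
have [c [d [c0 cd [del [M [del0 Hs]]]]]] := equicontinuous_on_interval J_itv fc qD e0.
have dc0 : 0 < d - c by rewrite subr_gt0.
pose m := Num.truncn (2 * h / (d - c)); pose r := h / m.+1%:R.
have r0 : 0 < r by rewrite divr_gt0.
have r2 : 2 * r < d - c.
  have : 2 * h / (d - c) < m.+1%:R by rewrite -truncn_le_nat.
  by rewrite ltr_pdivrMr// => hm; rewrite /r mulrA ltr_pdivrMr// [ltRHS]mulrC.
pose p := (Num.truncn (c / r)).+1.
have cp : c < p%:R * r by rewrite -ltr_pdivrMr// -truncn_le_nat.
have pd : p%:R * r + r <= d.
  have /andP[+ _] : (Num.truncn (c / r))%:R <= c / r < p%:R.
    by apply: truncn_itv; rewrite divr_ge0// ltW.
  by rewrite ler_pdivlMr// /p -natr1 mulrDl mul1r; lra.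
have hE : h = m.+1%:R * r by rewrite /r mulrC divfK// pnatr_eq0.
have pr0 : 0 <= p%:R * r by rewrite mulr_ge0// ltW.
have sub s : 0 <= s <= r -> c <= p%:R * r + s <= d by move=> /andP[]; lra.
exists (fun t => q t *: shift_mean r (shift_diff (p%:R * r) f) t +
  toF (- m.+1%:R^-1) *: \sum_(j < m.+1)
     q t *: shift_mean r (shift_diff (j%:R * r) f) t).
exists (fun t => q t *: (f t - shift_mean r f (t + p%:R * r))); split.
- apply: UCifD; first exact: qMD.
  apply: UCifZ; apply: UCif_sum => j; apply: qMD => //.
  by rewrite mulr_ge0// ltW.
- move=> t Jt; set S := fun j : nat => shift_mean r (shift_diff (j%:R * r) f) t.
  have MrE j : shift_mean r f (t + j%:R * r) = shift_mean r f t + S j.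
    have jr0 : 0 <= j%:R * r by rewrite mulr_ge0// ltW.
    by rewrite /S (shift_mean_shift_diff J_itv fc Jt jr0 r0) addrCA subrr addr0.
  have MhE : shift_mean h f t = shift_mean r f t + toF m.+1%:R^-1 *: \sum_(j < m.+1) S j.
    rewrite hE (shift_mean_split J_itv fc _ Jt r0).
    rewrite (eq_bigr (fun j : 'I_m.+1 => shift_mean r f t + S j)); last first.
      by move=> j _; exact: MrE.
    rewrite big_split/= sumr_const card_ord scalerDr -[shift_mean r f t *+ _]scaler_nat.
    by rewrite scalerA -toScalar_nat -toScalarM mulVf ?pnatr_eq0// toScalar1 scale1r.
  rewrite -/(q t) -/(S p) MhE MrE.
  have -> : \sum_(j < m.+1) q t *: shift_mean r (shift_diff (j%:R * r) f) t =
      q t *: \sum_(j < m.+1) S j by rewrite scaler_sumr.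
  move: (shift_mean r f t) (S p) (\sum_(j < m.+1) S j) => A P Z.
  rewrite [toF _ *: (q t *: _)]scalerA [toF _ * q t]mulrC.
  rewrite -[(q t * toF _) *: _]scalerA -!scalerDr; congr (_ *: _).
  rewrite -[- m.+1%:R^-1]sub0r toScalarB toScalar0 sub0r scaleNr.
  by rewrite !opprD [RHS]addrC !addrA subrK.
- exists del => // t t' Jt Jt' tt'.
  have Jtp := admissible_addr J_itv Jt pr0.
  have Jtp' := admissible_addr J_itv Jt' pr0.
  set P := shift_mean r f (t + _); set P' := shift_mean r f (t' + _).
  have -> : q t *: (f t - P) - q t' *: (f t' - P') =
      - (q t *: P - q t' *: P' - (q t *: f t - q t' *: f t')).
    by rewrite !scalerBr !opprB addrACA [RHS]addrACA [X in _ + X = _]addrC.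
  rewrite rnormN; apply: (shift_mean_dist_le J_itv) => // s /sub/Hs[+ _].
  move=> /(_ t t' Jt Jt' tt'); apply: le_trans.
  rewrite le_eqVlt; apply/orP; left; apply/eqP; congr rnorm.
  by rewrite /shift_diff !scalerBr !(addrA _ (p%:R * r)) opprD addrACA -opprD.
- move=> bdT; exists M => t Jt.
  have Jtp := admissible_addr J_itv Jt pr0.
  set P := shift_mean r f (t + _).
  have -> : q t *: (f t - P) = - (q t *: P - 0 *: P - q t *: f t).
    by rewrite scale0r subr0 opprB scalerBr.
  rewrite rnormN; apply: (shift_mean_dist_le J_itv) => // s /sub/Hs[_].
  by move=> /(_ bdT t Jt); rewrite scale0r subr0 -scalerBr /shift_diff addrA.
Qed.

End WeightedSpaces.

Theorem theorem4p3 (R : realType) (k : scalars)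
    (X : completeNormedModType (scalarField R k))
    (X_neq0 : exists x : X, x != 0)
    (J : set R) (J_itv : admissible_interval J)
    (gamma : R -> scalarField R k)
    (gamma_cont : {within J, continuous gamma})
    (gamma_neq0 : forall t, J t -> gamma t != 0) :
  (weighted J gamma (UC X J) `<=` mean_ext J (weighted J gamma (UC X J)) ->
     DeltaProp J (weighted J gamma (UC X J))) /\
  (weighted J gamma (BUC X J) `<=` mean_ext J (weighted J gamma (BUC X J)) ->
     DeltaProp J (weighted J gamma (BUC X J))).
Proof.
have UCE : UC X J = UCif false J by apply/seteqP; split=> f; [|case].
have BUCE : BUC X J = UCif true J.
  by apply/seteqP; split=> f [Uf fb]; split=> //; exact: fb.
by split; rewrite ?UCE ?BUCE; exact: weighted_UCif_DeltaProp.
Qed.
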